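(* Let $\Omega\subseteq\mathbb{R}^n$ be connected, let $0<\alpha\le 1$ and let $0<\beta\le 1$. If $f\in C^\alpha(\Omega)$ is non-negative, then $f^\beta\in C^{\alpha\beta}(\Omega)$ and $[f^\beta]_{\alpha\beta}\le [f]_\alpha^\beta$. In particular, if $f\in C^\alpha(\Omega)$ is non-negative then $\sqrt f\in C^{\frac{\alpha}{2}}(\Omega)$.
   Context: For $0<\alpha\le 1$ and a real-valued function $f$ on $\Omega$, $[f]_{\alpha}=[f]_{\alpha,\Omega}=\sup_{x,y\in\Omega,\,x\neq y}\frac{|f(x)-f(y)|}{|x-y|^\alpha}$, and $C^\alpha(\Omega)$ is the set of real-valued functions $f$ on $\Omega$ with $[f]_{\alpha,\Omega}<\infty$ (for $\alpha=1$ this means the Lipschitz functions on $\Omega$). *)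

(* Defs.v *)
From HB Require Import structures.
From mathcomp Require Import all_boot all_order all_algebra.
From mathcomp Require Import all_classical all_reals all_analysis.
Import Order.TTheory GRing.Theory Num.Theory.
Import numFieldNormedType.Exports.

Set Implicit Arguments.
Unset Strict Implicit.
Unset Printing Implicit Defensive.

Local Open Scope classical_set_scope.
Local Open Scope ring_scope.

(* The library norm `|x| on 'rV[R]_n is the sup norm (it induces the same
   topology, but not the same Hoelder quotients). *)
Definition enorm (R : realType) (n : nat) (x : 'rV[R]_n) : R :=
  Num.sqrt (\sum_(i < n) x ord0 i ^+ 2).

(* A function on Omega is a total function of which only the values on Omega
   matter. The supremum is taken in [0, +oo]: it is 0 when Omega has at most
   one point, whereas ereal_sup set0 = -oo. *)
Definition holder_seminorm (R : realType) (n : nat) (Omega : set 'rV[R]_n)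
    (alpha : R) (f : 'rV[R]_n -> R) : \bar R :=
  maxe 0%E (ereal_sup [set q : \bar R | exists x y : 'rV[R]_n,
    [/\ Omega x, Omega y, x <> y
      & q = (`|f x - f y| / enorm (x - y) `^ alpha)%:E]]).

Definition holder_space (R : realType) (n : nat) (Omega : set 'rV[R]_n)
    (alpha : R) : set ('rV[R]_n -> R) :=
  [set f | (holder_seminorm Omega alpha f < +oo)%E].

(* Main.v *)
(* For s, t >= 0 and 0 < b <= 1 one has |s^b - t^b| <= |s - t|^b, because
   s |-> s^b is subadditive. So each Hoelder quotient of f^b with exponent
   a * b is at most the b-th power of the quotient of f with exponent a. *)
Require Import Defs.
From HB Require Import structures.
From mathcomp Require Import all_boot all_order all_algebra.
From mathcomp Require Import all_classical all_reals all_analysis.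
Import Order.TTheory GRing.Theory Num.Theory.
Import numFieldNormedType.Exports.
Local Open Scope classical_set_scope.
Local Open Scope ring_scope.

Lemma powR_subadditive (R : realType) (b x y : R) :
  0 < b -> b <= 1 -> 0 <= x -> 0 <= y ->
  (x + y) `^ b <= x `^ b + y `^ b.
Proof.
(* The cases [x = 0] and [y = 0] go first, so that below both fractions of [x + y] lie in the
   interval from 0 (excluded) to 1. *)
move=> b_gt0 b_le1; rewrite le_eqVlt => /predU1P[<- _|x_gt0].
  by rewrite add0r lerDr powR_ge0.
rewrite le_eqVlt => /predU1P[<-|y_gt0]; first by rewrite addr0 lerDl powR_ge0.
have s_gt0 : 0 < x + y by rewrite addr_gt0.
(* A fraction t of the total satisfies t <= t^b; summing the two fractions
   gives 1 <= (x / s)^b + (y / s)^b with s = x + y. *)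
have part (z : R) : 0 < z -> z <= x + y ->
    (x + y) `^ b * (z / (x + y)) <= z `^ b.
  move=> z_gt0 z_le; rewrite -[in leRHS](divfK (lt0r_neq0 s_gt0) z).
  have zs_gt0 : 0 < z / (x + y) by rewrite divr_gt0.
  rewrite (powRM _ (ltW zs_gt0) (ltW s_gt0)) mulrC ler_pM2r ?powR_gt0//.
  by rewrite ger1_powR// zs_gt0 ler_pdivrMr// mul1r.
apply: le_trans (lerD (part x _ _) (part y _ _)) => //.
- by rewrite -mulrDr -mulrDl divff ?lt0r_neq0// mulr1.
- by rewrite lerDl ltW.
- by rewrite lerDr ltW.
Qed.

(** By symmetry one may take [y <= x]; both absolute values then open, and what remains is
    subadditivity for the splitting [x = (x - y) + y]. *)
Lemma dist_powR_le (R : realType) (b x y : R) :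
  0 < b -> b <= 1 -> 0 <= x -> 0 <= y ->
  `|x `^ b - y `^ b| <= `|x - y| `^ b.
Proof.
move=> b_gt0 b_le1; wlog le_yx : x y / y <= x => [hw x_ge0 y_ge0|x_ge0 y_ge0].
  by case/orP: (le_total y x) => ?; last rewrite distrC (distrC x); exact: hw.
have le_powR : y `^ b <= x `^ b by rewrite ge0_ler_powR ?nnegrE ?(ltW b_gt0).
rewrite !ger0_norm ?subr_ge0// lerBlDr -[in leLHS](subrK y x).
by rewrite powR_subadditive// subr_ge0.
Qed.

Lemma powRV (R : realType) (x b : R) : 0 <= x -> x^-1 `^ b = (x `^ b)^-1.
Proof. by move=> x_ge0; rewrite -powR_inv1// powRAC powR_inv1// powR_ge0. Qed.

Section holder.
Variables (R : realType) (n : nat) (Omega : set 'rV[R]_n).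
Implicit Types (a b : R) (f g : 'rV[R]_n -> R).

(** Used to exchange [Num.sqrt] for the power [2^-1]: the two are known to agree only at
    non-negative arguments, hence only on [Omega]. *)
Lemma eq_holder_seminorm a f g : (forall x, Omega x -> f x = g x) ->
  holder_seminorm Omega a f = holder_seminorm Omega a g.
Proof.
move=> fg; rewrite /holder_seminorm; congr (maxe _ (ereal_sup _)).
by apply/seteqP; split=> q [x [y [Ox Oy xy ->]]];
  exists x, y; split; rewrite // !fg.
Qed.

Lemma holder_seminorm_powR a b f : 0 < b -> b <= 1 ->
    (forall x, Omega x -> 0 <= f x) ->
  (holder_seminorm Omega (a * b) (fun x => (f x `^ b)%R)
     <= holder_seminorm Omega a f `^ b)%E.
Proof.
move=> b_gt0 b_le1 f_ge0; rewrite {1}/holder_seminorm ge_max poweR_ge0 /=.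
apply: ge_ereal_sup => _ [x [y [Ox Oy xy ->]]].
set q := `|f x - f y| / enorm (x - y) `^ a.
have q_ge0 : 0 <= q by rewrite divr_ge0 ?powR_ge0.
have q_le : (q%:E <= holder_seminorm Omega a f)%E.
  by rewrite le_max ereal_sup_ubound ?orbT//; exists x, y.
(* The exponent [a * b] in the denominator splits as a [b]-th power of an [a]-th power, so only the
   numerators are left to compare. *)
apply: (@le_trans _ _ (q%:E `^ b)%E).
  rewrite poweR_EFin lee_fin powRM ?invr_ge0 ?powR_ge0// powRV ?powR_ge0//.
  by rewrite powRrM ler_wpM2r ?invr_ge0 ?powR_ge0// dist_powR_le ?f_ge0.
(* The extended power is monotone on all of [[0, +oo]], so an infinite seminorm of [f] is covered as
   well. *)
apply: gt0_ler_poweR => //; first exact: ltW.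
- by rewrite in_itv /= leey lee_fin q_ge0.
- by rewrite in_itv /= leey (le_trans _ q_le)// lee_fin.
Qed.

Lemma holder_space_powR a b f : 0 < b -> b <= 1 ->
    (forall x, Omega x -> 0 <= f x) -> holder_space Omega a f ->
  holder_space Omega (a * b) (fun x => f x `^ b).
Proof.
move=> b_gt0 b_le1 f_ge0 f_holder.
exact: le_lt_trans (holder_seminorm_powR _ _ _ _ _ _) (poweR_lty _ f_holder).
Qed.

End holder.

Theorem corollary2p10 (R : realType) (n : nat) (Omega : set 'rV[R]_n)
    (alpha : R) (f : 'rV[R]_n -> R)
    (Omega_connected : connected Omega)
    (alpha_gt0 : 0 < alpha) (alpha_le1 : alpha <= 1)
    (f_holder : holder_space Omega alpha f)
    (f_ge0 : forall x, Omega x -> 0 <= f x) :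
  (forall beta : R, 0 < beta -> beta <= 1 ->
     holder_space Omega (alpha * beta) (fun x => f x `^ beta) /\
     (holder_seminorm Omega (alpha * beta) (fun x => (f x `^ beta)%R)
        <= holder_seminorm Omega alpha f `^ beta)%E) /\
  holder_space Omega (alpha / 2) (fun x => Num.sqrt (f x)).
Proof.
split=> [beta beta_gt0 beta_le1|].
  by split; [exact: holder_space_powR|exact: holder_seminorm_powR].
(* Since [alpha / 2] is [alpha * 2^-1], this is the case of exponent [2^-1]. *)
rewrite /holder_space /= (@eq_holder_seminorm _ _ _ _ _ (fun x => f x `^ 2^-1)).
  by apply: holder_space_powR; rewrite ?invr_gt0 ?invf_le1 ?ler1n.
by move=> x Ox; rewrite powR12_sqrt ?f_ge0.
Qed.
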